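(* The form $q_8=x_1^2+\cdots+x_8^2$ satisfies $$q_8^2=\frac{3}{256}\Bigl(\sum_{j=1}^8x_j\Bigr)^4+\frac{8}{9}\sum_{j=1}^8x_j^4-\frac{8}{9}\sum_{k=1}^8\Bigl(-\frac{3}{16}\sum_{j=1}^8x_j+x_k\Bigr)^4+\frac13\sum_{1\le j_1<j_2\le 8}\Bigl(-\frac38\sum_{j=1}^8x_j+(x_{j_1}+x_{j_2})\Bigr)^4.$$ *)

(* Defs.v *)
From HB Require Import structures.
From mathcomp Require Import all_boot all_order all_algebra.
From mathcomp Require Export mpoly.

Set Implicit Arguments.
Unset Strict Implicit.
Unset Printing Implicit Defensive.

Import GRing.Theory.
Local Open Scope ring_scope.

Definition q (F : fieldType) (n : nat) : {mpoly F[n]} := \sum_(i < n) 'X_i ^+ 2.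

(* Main.v *)
Require Import Defs.
From HB Require Import structures.
From mathcomp Require Import all_boot all_order all_algebra.
From mathcomp Require Import mpoly.
From mathcomp Require Import ring.

(** Both sides are symmetric quartic forms, so the identity is one between
    polynomials in the power sums p_1, ..., p_4 of the variables; write s for
    p_1.  Expanding the fourth powers around the shift
    ([sum_shift_exp4], [sum_pair_shift_exp4]) expresses everything through
    p_1, ..., p_4, once the sum over pairs j_1 < j_2 is replaced by half of the
    full double sum minus its diagonal ([sum_lt_pairs_sym]).  The pair shift
    -3s/8 is twice the single shift -3s/16, so each diagonal term
    (-3s/8 + 2 x_j)^4 is 16 times the corresponding single-variable term, and
    the diagonal cancels the 16 p_4 of the double sum; the two terms with
    coefficient 8/9 cancel their p_4 against each other.  The term p_2^2 occurs only in the double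
    sum, as 6 p_2^2, and 6 * 1/2 * 1/3 = 1 leaves q_8^2; the coefficients of
    s p_3, s^2 p_2 and s^4 cancel by arithmetic.

    To work without denominators, put s = 16 t, which turns the shifts into
    -3t and -6t, and multiply by 2304 = 9 * 256.  The resulting identity
    [quartic_identity_cleared] has integer coefficients and holds for any eight
    elements of any commutative ring; characteristic zero serves only to divide
    by 16 and by 2304. *)

Set Implicit Arguments.
Unset Strict Implicit.
Unset Printing Implicit Defensive.

Import GRing.Theory.
Local Open Scope ring_scope.

Section PowerSums.

Variables (A : comNzRingType) (n : nat) (x : 'I_n -> A).

Definition psum (k : nat) : A := \sum_i x i ^+ k.

Lemma psum1 : psum 1 = \sum_i x i.
Proof. by apply: eq_bigr => i _; rewrite expr1. Qed.

Lemma sum_const_natl (c : A) : \sum_(i < n) c = n%:R * c.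
Proof. by rewrite sumr_const card_ord mulr_natl. Qed.

Lemma sum_shift_exp4 (c : A) :
  \sum_i (c + x i) ^+ 4 =
    n%:R * c ^+ 4 + 4 * c ^+ 3 * psum 1 + 6 * c ^+ 2 * psum 2
    + 4 * c * psum 3 + psum 4.
Proof.
rewrite -sum_const_natl /psum !mulr_sumr -!big_split /=.
by apply: eq_bigr => i _; ring.
Qed.

(** The inner sum is [sum_shift_exp4] at the shift c + x_i; what is left is a
    polynomial in x_i whose coefficients do not depend on i. *)
Lemma sum_pair_shift_exp4 (c : A) :
  \sum_i \sum_j (c + (x i + x j)) ^+ 4 =
    n%:R ^+ 2 * c ^+ 4 + 8 * n%:R * c ^+ 3 * psum 1
    + 12 * c ^+ 2 * (n%:R * psum 2 + psum 1 ^+ 2)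
    + 8 * c * (n%:R * psum 3 + 3 * psum 1 * psum 2)
    + 2 * n%:R * psum 4 + 8 * psum 1 * psum 3 + 6 * psum 2 ^+ 2.
Proof.
(* Writing x i ^+ 1 lets the sum over i of this term be read as psum 1. *)
have inner i : \sum_j (c + (x i + x j)) ^+ 4 =
    n%:R * (c + x i) ^+ 4
    + 4 * psum 1 * (c ^+ 3 + 3 * c ^+ 2 * x i ^+ 1 + 3 * c * x i ^+ 2
                    + x i ^+ 3)
    + 6 * psum 2 * (c ^+ 2 + 2 * c * x i ^+ 1 + x i ^+ 2)
    + 4 * psum 3 * (c + x i ^+ 1) + psum 4.
  under eq_bigr => j _ do rewrite addrA.
  by rewrite sum_shift_exp4; ring.
under eq_bigr => i _ do rewrite inner.
rewrite !big_split -!mulr_sumr sum_shift_exp4 !big_split -!mulr_sumr /=.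
rewrite !sum_const_natl -/(psum 1) -/(psum 2) -/(psum 3); ring.
Qed.

End PowerSums.

Lemma sum_lt_pairs_sym (A : nmodType) (n : nat) (f : 'I_n -> 'I_n -> A) :
  (forall i j, f i j = f j i) ->
  \sum_i \sum_j f i j =
    (\sum_(i < n) \sum_(j < n | (i < j)%N) f i j) *+ 2 + \sum_i f i i.
Proof.
move=> fC.
have split_row i : \sum_j f i j =
    \sum_(j < n | (i < j)%N) f i j + \sum_(j < n | (j < i)%N) f i j + f i i.
  rewrite (bigD1 i) //= addrC; congr (_ + _).
  rewrite (bigID (fun j : 'I_n => (i < j)%N)) /=.
  by congr (_ + _); apply: eq_bigl => j; rewrite -val_eqE /=; case: ltngtP.
under eq_bigr => i _ do rewrite split_row.
rewrite !big_split /= mulr2n; congr (_ + _ + _).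
rewrite (exchange_big_dep predT) //=.
by apply: eq_bigr => j _; apply: eq_bigr => i _; rewrite fC.
Qed.

Lemma quartic_identity_cleared (A : comNzRingType) (x : 'I_8 -> A) (t : A) :
  \sum_i x i = 16 * t ->
  2304 * (\sum_i x i ^+ 2) ^+ 2 =
    27 * (\sum_i x i) ^+ 4 + 2048 * (\sum_i x i ^+ 4)
    - 2048 * (\sum_i (- 3 * t + x i) ^+ 4)
    + 768 * (\sum_(i < 8) \sum_(j < 8 | (i < j)%N) (- 6 * t + (x i + x j)) ^+ 4).
Proof.
move=> sum_x.
have symm i j : (- 6 * t + (x i + x j)) ^+ 4 = (- 6 * t + (x j + x i)) ^+ 4.
  by rewrite [x i + _]addrC.
have := sum_lt_pairs_sym symm.
rewrite sum_pair_shift_exp4.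
have -> : \sum_i (- 6 * t + (x i + x i)) ^+ 4 =
          16 * \sum_i (- 3 * t + x i) ^+ 4.
  by rewrite mulr_sumr; apply: eq_bigr => i _; ring.
rewrite sum_shift_exp4 -/(psum x 2) -/(psum x 4) psum1 sum_x.
set P := \sum_i _ => pairs.
(* Only 2 P is known, and 768 = 384 * 2. *)
have -> : 768 * P = 384 * (P *+ 2) by ring.
by rewrite -(canLR (addrK _) pairs); ring.
Qed.

Theorem theorem5p15 (F : fieldType) (charF0 : [pchar F] =i pred0) :
  q F 8 ^+ 2 =
    (3 / 256 : F) *: (\sum_(j < 8) 'X_j) ^+ 4
    + (8 / 9 : F) *: (\sum_(j < 8) 'X_j ^+ 4)
    - (8 / 9 : F) *:
        (\sum_(k < 8) ((- (3 / 16) : F) *: (\sum_(j < 8) 'X_j) + 'X_k) ^+ 4)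
    + (1 / 3 : F) *:
        (\sum_(j1 < 8) \sum_(j2 < 8 | (j1 < j2)%N)
           ((- (3 / 8) : F) *: (\sum_(j < 8) 'X_j) + ('X_j1 + 'X_j2)) ^+ 4)
    :> {mpoly F[8]}.
Proof.
have natF_neq0 m : (0 < m)%N -> (m%:R : F) != 0.
  by rewrite ((pcharf0P F).1 charF0) lt0n.
have n3 : (3 : F) != 0 by apply: natF_neq0.
have n9 : (9 : F) != 0 by apply: natF_neq0.
have n16 : (16 : F) != 0 by apply: natF_neq0.
have n8 : (8 : F) != 0 by apply: natF_neq0.
have n256 : (256 : F) != 0 by apply: natF_neq0.
have n2304 : (2304 : F) != 0 by apply: natF_neq0.
have natZ m (p : {mpoly F[8]}) : (m%:R : F) *: p = m%:R * p.
  by rewrite scaler_nat mulr_natl.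
set s : {mpoly F[8]} := \sum_(j < 8) 'X_j.
pose t : {mpoly F[8]} := (1 / 16 : F) *: s.
have sE : s = 16 * t by rewrite -natZ scalerA mulrCA mulfV // mulr1 scale1r.
have -> : (- (3 / 16) : F) *: s = - 3 * t.
  by rewrite mulNr -natZ scalerA -scaleNr; congr (_ *: _); field.
have -> : (- (3 / 8) : F) *: s = - 6 * t.
  rewrite mulNr -natZ scalerA -scaleNr; congr (_ *: _); field.
  by rewrite n8 n16.
apply: (scalerI n2304); rewrite !scalerDr scalerN !scalerA.
have -> : (2304 * (3 / 256) : F) = 27 by field.
have -> : (2304 * (8 / 9) : F) = 2048 by field.
have -> : (2304 * (1 / 3) : F) = 768 by field.
by rewrite !natZ; apply: quartic_identity_cleared.
Qed.
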